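(* Let $\varphi(x,y,\vec z_1,\ldots,\vec z_n)$ be a first-order formula in the full language on $\mathbb N$, where $x,y$ are single variables and $\vec z_1,\ldots,\vec z_n$ are (possibly empty) finite lists of variables. The following are equivalent. 1. $\varphi$ is Ramsey PR in $(x,y),\vec z_1\mid\ldots\mid\vec z_n$; that is, for all finite colourings $\mathbb N=C_1\cup\ldots\cup C_r$ there are a colour $i_1\le r$, an infinite set $H\subseteq C_{i_1}$, and colours $i_2,\ldots,i_n$ such that for all $h_1<h_2$ in $H$ there exist $\vec a_1\in C_{i_1},\ldots,\vec a_n\in C_{i_n}$ satisfying $\varphi(h_1,h_2,\vec a_1,\ldots,\vec a_n)$. 2. For all finite colourings $\mathbb N=C_1\cup\ldots\cup C_r$ there is an infinite set $H$ such that for all $h_1<h_2$ in $H$ there exist colours $i_1,\ldots,i_n$ with $h_1,h_2\in C_{i_1}$, and there exist $\vec a_1\in C_{i_1},\ldots,\vec a_n\in C_{i_n}$ satisfying $\varphi(h_1,h_2,\vec a_1,\ldots,\vec a_n)$. 3. There are a Ramsey pair $(\alpha,\beta)$ and lists $\vec\gamma_1,\ldots,\vec\gamma_n$ of elements of ${}^*\mathbb N$ such that: for all $i\le n$ and all $h,k\le l(\vec z_i)$ we have $(\vec\gamma_i)_h\sim(\vec\gamma_i)_k$; if $l(\vec z_1)\ge1$ then $\alpha\sim(\vec\gamma_1)_1$; and $\varphi(\alpha,\beta,\vec\gamma_1,\ldots,\vec\gamma_n)$ holds (in ${}^*\mathbb N$). 4. There exist $u\in\mathrm{RW}\subseteq\beta\mathbb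 N^2$ and $u_1,\ldots,u_n\in\beta\mathbb N$ such that: $\pi_1(u)=u_1$, where $\pi_1$ is the map $\beta\mathbb N^2\to\beta\mathbb N$ induced by the projection on the first coordinate; and for all $A\in u$, $B_1\in u_1,\ldots,B_n\in u_n$ there exists an infinite set $H\subseteq B_1$ such that $[H]^2\subseteq A$ and for all $h_1<h_2$ in $H$ there are $\vec b_1\in B_1,\ldots,\vec b_n\in B_n$ such that $\varphi(h_1,h_2,\vec b_1,\ldots,\vec b_n)$ holds.
   Context: $\mathbb N$ is the set of positive integers. ${}^*\mathbb N$ is a fixed $\mathfrak c^+$-saturated elementary extension (nonstandard extension) of $\mathbb N$ equipped with its full first-order structure (a symbol for every subset of every $\mathbb N^k$); ${}^*A$ is the nonstandard extension of $A\subseteq\mathbb N^k$. For $\alpha\in{}^*\mathbb N^k$, $\mathfrak u(\alpha)=\{A\subseteq\mathbb N^k\mid\alpha\in{}^*A\}\in\beta\mathbb N^k$ (the space of ultrafilters on $\mathbb N^k$), and $\alpha\sim\alpha'$ means $\mathfrak u(\alpha)=\mathfrak u(\alpha')$. For a list $\vec x$, $l(\vec x)$ is its length (length $0$ is allowed) and $(\vec x)_i$ its $i$-th entry; $\vec a\in A$ is shorthand for $\vec a\in A^{l(\vec a)}$. The lists $\vec a_i,\vec b_i,\vec\gamma_i$ have the same length as $\vec z_i$. For $H\subseteq\mathbb N$, $[H]^2=\{(h_1,h_2)\in H^2\mid h_1<h_2\}$. An ultrafilter $u$ on $\mathbb N^2$ is a Ramsey's witness, $u\in\mathrm{RW}$,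 if for every $A\in u$ there is an infinite $H\subseteq\mathbb N$ with $[H]^2\subseteq A$. A pair $(\alpha,\beta)\in{}^*\mathbb N^2$ is a Ramsey pair if $\mathfrak u(\alpha,\beta)\in\mathrm{RW}$. *)

(* Defs.v *)
From mathcomp Require Import all_boot all_classical filter.

Set Implicit Arguments.
Unset Strict Implicit.
Unset Printing Implicit Defensive.

Local Open Scope classical_set_scope.
Local Open Scope card_scope.

Definition posnat : Type := {m : nat | (0 < m)%N}.

Definition posnat_lt (a b : posnat) : Prop := (sval a < sval b)%N.

(* First-order formulas, with equality, in the full language on the positive
   integers: the relation symbols of arity k are the subsets of posnat^k.
   The free variables of a term of type [formula V] are among the elements of
   V; [Forall f] binds the variable [None] of [f]. The other connectives and
   the existential quantifier are the usual (classical) abbreviations. *)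
Inductive formula (V : Type) : Type :=
| Equal of V & V
| Atom (k : nat) of set (k.-tuple posnat) & k.-tuple V
| Falsum
| Implies of formula V & formula V
| Forall of formula (option V).

Record structure := Structure {
  carrier :> Type;
  interp : forall k, set (k.-tuple posnat) -> set (k.-tuple carrier)
}.

Arguments interp s [k].

Definition standard : structure := @Structure posnat (fun _ A => A).

Definition extend (V T : Type) (x : T) (rho : V -> T) (v : option V) : T :=
  if v is Some w then rho w else x.

Fixpoint sat (M : structure) (V : Type) (rho : V -> M) (f : formula V) : Prop :=
  match f with
  | Equal v w => rho v = rho w
  | Atom k A t => interp M A (map_tuple rho t)
  | Falsum => False
  | Implies g h => sat rho g -> sat rho h
  | Forall g => forall x : M, sat (extend x rho) g
  end.

Definition elementary_embedding (M : structure) (star : posnat -> M) : Prop :=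
  forall (k : nat) (f : formula 'I_k) (rho : 'I_k -> posnat),
    sat (M := standard) rho f <-> sat (star \o rho) f.

(* kappa-saturation for kappa the successor of the cardinality c of the
   continuum: parameter sets have cardinality less than kappa, that is, at most
   c, the cardinality of the powerset of posnat. In a formula over [option A],
   [None] is the variable of the type and [Some a] is the parameter a. *)
Definition continuum_succ_saturated (M : structure) : Prop :=
  forall A : set M, A #<= [set: set posnat] ->
  forall p : set (formula (option A)),
    (forall q, q `<=` p -> finite_set q ->
       exists x : M, forall f, q f -> sat (extend x (fun a : A => sval a)) f) ->
    exists x : M, forall f, p f -> sat (extend x (fun a : A => sval a)) f.

Definition ultra_of (M : structure) (k : nat) (a : k.-tuple M) :
    set_system (k.-tuple posnat) :=
  [set A | interp M A a].

Definition same_type (M : structure) (a b : M) : Prop :=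
  ultra_of [tuple a] = ultra_of [tuple b].

Definition coord1 (t : 2.-tuple posnat) : posnat := tnth t ord0.
Definition coord2 (t : 2.-tuple posnat) : posnat := tnth t ord_max.

Definition increasing_pairs (H : set posnat) : set (2.-tuple posnat) :=
  [set t | [/\ H (coord1 t), H (coord2 t) & posnat_lt (coord1 t) (coord2 t)]].

Definition Ramsey_witness (u : set_system (2.-tuple posnat)) : Prop :=
  UltraFilter u /\
  forall A, u A -> exists H, infinite_set H /\ increasing_pairs H `<=` A.

Definition Ramsey_pair (M : structure) (a b : M) : Prop :=
  Ramsey_witness (ultra_of [tuple a; b]).

Definition finite_colouring (r : nat) (C : 'I_r -> set posnat) : Prop :=
  \bigcup_i C i = [set: posnat] /\ trivIset setT C.

(* The variables x, y, z_1, ..., z_(m+1), where z_i is a list of length l i;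
   list indices start at 0, so z_1 and i_1 correspond to the index ord0. *)
Inductive variable (m : nat) (l : 'I_m.+1 -> nat) : Type :=
| VarX
| VarY
| VarZ (i : 'I_m.+1) of 'I_(l i).

Definition assign (m : nat) (l : 'I_m.+1 -> nat) (T : Type) (x y : T)
    (c : forall i, (l i).-tuple T) (v : variable l) : T :=
  match v with
  | VarX => x
  | VarY => y
  | VarZ i j => tnth (c i) j
  end.

Definition holds (M : structure) (m : nat) (l : 'I_m.+1 -> nat)
    (phi : formula (variable l)) (x y : M) (c : forall i, (l i).-tuple M) : Prop :=
  sat (assign x y c) phi.

Definition list_in (T : Type) (k : nat) (t : k.-tuple T) (A : set T) : Prop :=
  forall j, A (tnth t j).

Definition Ramsey_PR (m : nat) (l : 'I_m.+1 -> nat)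
    (phi : formula (variable l)) : Prop :=
  forall (r : nat) (C : 'I_r -> set posnat), finite_colouring C ->
  exists (i : 'I_m.+1 -> 'I_r) (H : set posnat),
    [/\ infinite_set H, H `<=` C (i ord0) &
      forall h1 h2, H h1 -> H h2 -> posnat_lt h1 h2 ->
      exists a : forall s, (l s).-tuple posnat,
        (forall s, list_in (a s) (C (i s))) /\
        holds (M := standard) phi h1 h2 a].

(* Main.v *)
Require Import Defs.
From HB Require Import structures.
From mathcomp Require Import all_boot all_classical filter.

(* The sets of pairs containing no [H]^2 with H infinite form an ideal, by
   Ramsey's theorem. By (2), no such set covers the pairs solved monochromatically
   for a given finite colouring, and finite colourings have common refinements:
   hence some ultrafilter on assignments avoids this ideal, contains the solutions
   of phi, and makes the required coordinates agree on every colouring. An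
   assignment realising it in M, obtained by saturation, is as in (3). Conversely,
   a universal sentence satisfied in the standard structure transfers to M; applied
   to "phi and z_i in B_i imply that (x,y) is in D", for D the set of standard pairs
   with such a solution, it puts D in u(alpha,beta), which gives (4). *)

Local Open Scope classical_set_scope.

(** * Renaming of variables and derived connectives *)

Fixpoint rename {V W : Type} (e : V -> W) (f : formula V) : formula W :=
  match f with
  | Equal v w => Equal (e v) (e w)
  | Atom k A t => Atom A (map_tuple e t)
  | Falsum => Falsum W
  | Defs.Implies g h => Defs.Implies (rename e g) (rename e h)
  | Forall g => Forall (rename (omap e) g)
  end.

Lemma sat_rename {M : structure} {V W : Type} (e : V -> W) (rho : W -> M)
    (f : formula V) :
  sat rho (rename e f) <-> sat (rho \o e) f.
Proof.
elim: f W e rho => {V} [V v w|V k A t|V|V g IHg h IHh|V g IHg] W e rho //=.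
- suff -> : map_tuple rho (map_tuple e t) = map_tuple (rho \o e) t by [].
  by apply: eq_from_tnth => i; rewrite !tnth_map.
- by split=> H /IHg /H /IHh.
- have E x : extend x rho \o omap e = extend x (rho \o e) by apply/funext; case.
  by split=> H x; [rewrite -E; apply/IHg|apply/IHg; rewrite E].
Qed.

Definition exists_formula {V : Type} (f : formula (option V)) : formula V :=
  Defs.Implies (Forall (Defs.Implies f (Falsum _))) (Falsum V).

Lemma sat_exists {M : structure} {V : Type} (rho : V -> M)
    (f : formula (option V)) :
  sat rho (exists_formula f) <-> exists x, sat (extend x rho) f.
Proof.
split=> [H|[x fx] /(_ x) /(_ fx)] //=.
by apply: contrapT => nf; apply: H => x fx; apply: nf; exists x.
Qed.

Lemma sat_foldr_implies {M : structure} {V : Type} {I : eqType} (s : seq I)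
    (h : I -> formula V) (g : formula V) (rho : V -> M) :
  sat rho (foldr (fun i => Defs.Implies (h i)) g s) <->
  ((forall i, i \in s -> sat rho (h i)) -> sat rho g).
Proof.
elim: s => [|i s IH] /=; first by split=> [//|]; apply.
split=> [H hs|H hi].
  have /IH := H (hs i (mem_head i s)); apply => j sj.
  by apply: hs; rewrite inE sj orbT.
by apply/IH => hs; apply: H => j /[!inE] /predU1P[->//|/hs].
Qed.

(** * General facts on ultrafilters *)

Lemma ultrafilter_of_compl {T : Type} (F : set_system T) : ProperFilter F ->
  (forall A, F A \/ F (~` A)) -> UltraFilter F.
Proof.
move=> PF complF; split=> // G PG FG; apply/seteqP; split=> // A GA.
have [//|/FG GNA] := complF A.
have [] := @filter_not_empty _ G _.
by rewrite -(setICr A); apply: filterI.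
Qed.

Lemma ultrafilter_fmap {T U : Type} (f : T -> U) (F : set_system T) :
  UltraFilter F -> UltraFilter (fmap f F).
Proof.
move=> UF; apply: ultrafilter_of_compl => A.
exact: (in_ultra_setVsetC (f @^-1` A) UF).
Qed.

Lemma ultrafilter_colour {T : Type} {I : finType} (F : set_system T)
    (C : I -> set T) :
  UltraFilter F -> \bigcup_i C i = [set: T] -> exists i, F (C i).
Proof.
move=> UF CT; apply: contrapT => nFC.
have /filter_forall/filter_ex[x nCx] : forall i, F (~` C i).
  by move=> i; have [FC|//] := in_ultra_setVsetC (C i) UF; case: nFC; exists i.
by have [i _ /nCx] : (\bigcup_i C i) x by rewrite CT.
Qed.

(** * Transfer of universal statements to [M] *)

Section Transfer.
Context {M : structure} {star : posnat -> M}.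
Hypothesis star_elementary : elementary_embedding star.

(** Elementarity only concerns assignments with values in the image of [star]. Quantifying the
    variables universally, one at a time, leads to a sentence, whose empty assignment factors
    through [star]. *)
Lemma transfer_ord (k : nat) (f : formula 'I_k) :
  (forall rho, sat (M := standard) rho f) -> forall rho : 'I_k -> M, sat rho f.
Proof.
elim: k f => [|k IH] f std_f rho.
  have rho0 : 'I_0 -> posnat by case.
  have -> : rho = star \o rho0 by apply/funext => -[].
  exact/star_elementary.
(* [unlift ord0] turns the variable [ord0] into the bound variable [None]. *)
have: sat (rho \o lift ord0) (Forall (rename (unlift ord0) f)).
  by apply: IH => rho' x; apply/sat_rename.
move=> /(_ (rho ord0)) /sat_rename.
suff -> : extend (rho ord0) (rho \o lift ord0) \o unlift ord0 = rho by [].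
by apply/funext => i /=; case: unliftP => [j|] ->.
Qed.

Lemma transfer {V : finType} (f : formula V) :
  (forall rho, sat (M := standard) rho f) -> forall rho : V -> M, sat rho f.
Proof.
move=> std_f rho.
have: sat (rho \o enum_val) (rename enum_rank f).
  by apply: transfer_ord => rho'; apply/sat_rename.
move/sat_rename; suff -> : (rho \o enum_val) \o enum_rank = rho by [].
by apply/funext => v /=; rewrite enum_rankK.
Qed.

Lemma transfer_consequence {V I : finType} (h : I -> formula V)
    (g : formula V) :
  (forall rho, (forall i, sat (M := standard) rho (h i)) ->
     sat (M := standard) rho g) ->
  forall rho : V -> M, (forall i, sat rho (h i)) -> sat rho g.
Proof.
move=> std rho hi.
have /sat_foldr_implies : sat rho (foldr (fun i => Defs.Implies (h i)) g (enum I)).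
  apply: transfer => rho'; apply/sat_foldr_implies => hs.
  by apply: std => i; apply: hs; rewrite mem_enum.
by apply => i _; apply: hi.
Qed.

(** For fixed sets, each ultrafilter axiom is a propositional combination of atoms that is true of
    all standard tuples, so it transfers to [a]. *)
Lemma ultra_of_ultrafilter (k : nat) (a : k.-tuple M) :
  UltraFilter (ultra_of a).
Proof.
have aE : a = map_tuple (tnth a) (ord_tuple k).
  by apply: eq_from_tnth => i; rewrite tnth_map tnth_ord_tuple.
have T (f : formula 'I_k) : (forall rho, sat (M := standard) rho f) ->
  sat (tnth a) f by move=> /transfer; apply.
pose at_ A := Atom A (ord_tuple k).
have at_E A : sat (tnth a) (at_ A) = ultra_of a A by rewrite /= -aE.
have monoP (P Q : set (k.-tuple posnat)) :
    P `<=` Q -> ultra_of a P -> ultra_of a Q.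
  rewrite -!at_E => PQ; apply: (T (Defs.Implies (at_ P) (at_ Q))) => rho /=.
  exact: PQ.
have interP (P Q : set (k.-tuple posnat)) :
    ultra_of a P -> ultra_of a Q -> ultra_of a (P `&` Q).
  rewrite -!at_E.
  by apply: (T (Defs.Implies (at_ P) (Defs.Implies (at_ Q) (at_ (P `&` Q))))) => rho.
have emptyP : ~ ultra_of a set0.
  by rewrite -at_E; apply: (T (Defs.Implies (at_ set0) (Falsum _))) => rho.
have complP P : ~ ultra_of a P -> ultra_of a (~` P).
  rewrite -!at_E; apply: (T (Defs.Implies (Defs.Implies (at_ P) (Falsum _)) (at_ (~` P)))).
  by move=> rho.
apply: ultrafilter_of_compl => [|A].
  by split=> //; split=> //; rewrite -at_E; apply: T.
by have [|/complP] := pselect (ultra_of a A); [left|right].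
Qed.

End Transfer.

(** * Ramsey's theorem for pairs, by a nonprincipal ultrafilter *)

Lemma finite_not_posnat_gt (h : posnat) : finite_set [set x | ~ posnat_lt h x].
Proof.
apply: (@sub_finite_set _ _ (sval @^-1` `I_(sval h).+1)).
  by move=> x /= /negP; rewrite -leqNgt ltnS.
apply: finite_preimage; last exact: finite_II.
by move=> x y _ _ /val_inj.
Qed.

Lemma infinite_exists_gt {H : set posnat} (h : posnat) :
  infinite_set H -> exists2 x, H x & posnat_lt h x.
Proof.
move=> infH; apply: contrapT => nH; apply: infH.
apply: sub_finite_set (finite_not_posnat_gt h) => x Hx hx.
by apply: nH; exists x.
Qed.

Lemma nonprincipal_ultrafilter {T : Type} {H : set T} : infinite_set H ->
  exists W : set_system T, [/\ UltraFilter W, W H &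
    forall A, finite_set (~` A) -> W A].
Proof.
(* The members of [F] contain all but finitely many elements of [H]; [F] is proper because [H] is
   infinite. *)
move=> infH; pose F : set_system T := [set A | finite_set (H `\` A)].
have PF : ProperFilter F.
  split; first by rewrite /F /= setD0.
  split=> [|A B FA FB|A B AB]; rewrite /F /=.
  - by rewrite setDT.
  - by rewrite setDIr finite_setU.
  - by apply: sub_finite_set; apply: setDS.
have [W [UW FW]] := ultraFilterLemma PF; exists W; split => //.
  by apply: FW; rewrite /F /= setDv.
by move=> A finA; apply: FW; apply: sub_finite_set finA => x [].
Qed.

(** A Ramsey witness is an ultrafilter all of whose members have this property. *)
Definition contains_pairs (A : set (2.-tuple posnat)) : Prop :=
  exists H, infinite_set H /\ increasing_pairs H `<=` A.

Lemma tuple2E (t : 2.-tuple posnat) : t = [tuple coord1 t; coord2 t].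
Proof.
apply: val_inj; rewrite /= /coord1 /coord2 !(tnth_nth (coord1 t)).
by case: t => -[|a [|b []]].
Qed.

(* A maximal homogeneous subset of a set of the nonprincipal ultrafilter [W]
   is infinite, as finitely many conditions in [W] have a common solution. *)
Lemma infinite_homogeneous {W : set_system posnat} {X : set posnat}
    {A : set (2.-tuple posnat)} :
  UltraFilter W -> (forall B, finite_set (~` B) -> W B) -> W X ->
  (forall x, X x -> W [set y | A [tuple x; y]]) -> contains_pairs A.
Proof.
move=> UW cofW WX XA.
pose P : set (set posnat) := [set H | H `<=` X /\ increasing_pairs H `<=` A].
have [F FP totF|H [[HX HA] maxH]] := @Zorn_bigcup _ P.
  split=> [x [H /FP[HX _]] /HX //|t [[H FH Hx] [K FK Ky] xy]].
  have [HK|KH] := totF _ _ FH FK.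
    by have [_] := FP _ FK; apply; split => //; apply: HK.
  by have [_] := FP _ FH; apply; split => //; apply: KH.
exists H; split => // finH.
(* A common element of the [N y] lies above all of [H], so it is new, and the only new increasing
   pairs have it as second coordinate. *)
pose N y := [set z | posnat_lt y z /\ A [tuple y; z]].
have WN y : H y -> W (N y).
  move=> /HX /XA WA; apply: filterI (WA).
  by apply: cofW; apply: sub_finite_set (finite_not_posnat_gt y).
have : W (X `&` \bigcap_(y in H) N y).
  apply: filterI => //; have [D HD] := iffLR finite_fsetP finH; rewrite HD.
  by apply: filter_bigI => y yD; apply: WN; rewrite HD.
move=> /filter_ex[z [Xz Hz]].
apply: (maxH (z |` H)).
  split=> [y Hy|]; first by right.
  move=> /(_ z (or_introl erefl)) Hz'; have [+ _] := Hz _ Hz'.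
  by rewrite /posnat_lt ltnn.
split=> [_ [->//|/HX//]|t [[tz|t1] [tz'|t2] lt12]].
- by move: lt12; rewrite tz tz' /posnat_lt ltnn.
- have [+ _] := Hz _ t2; rewrite -tz /posnat_lt => /ltnW.
  by rewrite leqNgt lt12.
- by rewrite (tuple2E t) tz'; apply: (Hz _ t1).2.
- by apply: HA.
Qed.

(** Ask of each [x] whether [W]-most [y] are joined to it by [A]. If [W]-most [x] say yes, [A] has
    an infinite homogeneous set. Otherwise, for [W]-most [x] in [H], [W]-most [y] lie in [H] above
    [x] and are not joined to it by [A], hence are joined by [B]. *)
Lemma Ramsey_union (A B : set (2.-tuple posnat)) :
  contains_pairs (A `|` B) -> contains_pairs A \/ contains_pairs B.
Proof.
move=> [H [infH HAB]].
have [W [UW WH cofW]] := nonprincipal_ultrafilter infH.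
pose nbr (C : set (2.-tuple posnat)) x := [set y | C [tuple x; y]].
have [WA|WB] := in_ultra_setVsetC [set x | W (nbr A x)] UW.
  by left; apply: infinite_homogeneous WA _.
right; apply: (infinite_homogeneous UW cofW (filterI WH WB)) => x [Hx nAx].
have [//|WnA] := in_ultra_setVsetC (nbr A x) UW.
have Wgt : W [set y | posnat_lt x y].
  by apply: cofW; apply: sub_finite_set (finite_not_posnat_gt x).
apply: filterS (filterI (filterI WH Wgt) WnA) => y [[Hy xy] nA].
by have [] : (A `|` B) [tuple x; y] by apply: HAB; split.
Qed.

(** * Realising an ultrafilter on assignments by saturation *)

Lemma sat_atom1 {M : structure} {V : Type} (rho : V -> M)
    (S : set (1.-tuple posnat)) (v : V) :
  sat rho (Atom S [tuple v]) = interp M S [tuple rho v].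
Proof. by congr (interp M S _); apply: val_inj. Qed.

Lemma sat_atom2 {M : structure} {V : Type} (rho : V -> M)
    (S : set (2.-tuple posnat)) (v w : V) :
  sat rho (Atom S [tuple v; w]) = interp M S [tuple rho v; rho w].
Proof. by congr (interp M S _); apply: val_inj. Qed.

Lemma posnat_coding (V : finType) :
  exists (code : (V -> posnat) -> posnat) (decode : posnat -> V -> posnat),
    cancel code decode.
Proof.
pose one : posnat := exist _ 1 isT.
(* [pickle] may return 0, hence the successor here and the predecessor in [decode], where [one] is
   the default value if unpickling fails. *)
pose code (r : V -> posnat) : posnat :=
  exist _ (pickle [ffun v => r v]).+1 (ltn0Sn _).
pose decode (x : posnat) : V -> posnat :=
  odflt [ffun=> one] (unpickle (sval x).-1).
exists code, decode => r.
by apply/funext => v; rewrite /decode /= pickleK /= ffunE.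
Qed.

(* Coding assignments by single elements reduces the realisation of [U] to that
   of a type in one variable without parameters. *)
Lemma realise_ultrafilter {M : structure} {star : posnat -> M}
    (star_elementary : elementary_embedding star)
    (M_saturated : continuum_succ_saturated M) {V : finType}
    (U : set_system (V -> posnat)) : UltraFilter U ->
  exists rho : V -> M, forall g : formula V,
    U [set r | sat (M := standard) r g] -> sat rho g.
Proof.
move=> UU; have [code [decode codeK]] := posnat_coding V.
pose p : set (formula (option (set0 : set M))) :=
  [set f | exists2 S : set (1.-tuple posnat), f = Atom S [tuple None] &
     U [set r | S [tuple code r]]].
have [q qp finq|x xp] := M_saturated set0 (card_ge0 _ _) p.
  (* Finitely many conditions of [p] define sets in [U], so some [code r] satisfies them all, and
     then so does [star (code r)] in [M]. *)
  pose sat_at (f : formula (option (set0 : set M))) : set (V -> posnat) :=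
    [set r | sat (M := standard) (fun _ => code r) f].
  have [D qD] := iffLR (@finite_fsetP {classic _} _) finq.
  have /filter_ex[r qr] : U (\bigcap_(f in q) sat_at f).
    rewrite qD; apply: (@filter_bigI _ _ D sat_at) => f fD.
    have /qp[S -> US] : q f by rewrite qD.
    by apply: filterS US => r; rewrite /sat_at /mkset sat_atom1.
  exists (star (code r)) => f qf; have [S fE _] := qp _ qf.
  have := qr _ qf; rewrite fE /sat_at /mkset !sat_atom1 /= => Scode.
  have := star_elementary 1 (Atom S [tuple ord0]) (fun=> code r).
  by rewrite !sat_atom1 => /iffLR; apply.
have {}xp S : U [set r | S [tuple code r]] -> interp M S [tuple x].
  move=> US; have /xp : p (Atom S [tuple None]) by exists S.
  by rewrite sat_atom1.
(* The coordinates of [decode] become binary relations; their totality transfers and provides the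
   coordinates [rho v] of [x]. *)
pose graph v : set (2.-tuple posnat) :=
  [set t | coord2 t = decode (coord1 t) v].
have graphx v : exists y, interp M (graph v) [tuple x; y].
  have /(transfer star_elementary)/(_ (fun=> x))/sat_exists[y] :
      forall r : unit -> posnat, sat (M := standard) r
        (exists_formula (Atom (graph v) [tuple Some tt; None])).
    move=> r; apply/sat_exists; exists (decode (r tt) v).
    by rewrite sat_atom2.
  by rewrite sat_atom2 => ?; exists y.
have /choice[rho rhoP] := graphx.
exists rho => g Ug.
pose S : set (1.-tuple posnat) :=
  [set t | sat (M := standard) (decode (thead t)) g].
(* In the standard structure these premises say that the variables decode an element of [S], so that
   [g] holds; this consequence transfers. *)
pose prem (i : option V) : formula (option V) :=
  if i is Some v then Atom (graph v) [tuple None; Some v]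
  else Atom S [tuple None].
have : sat (extend x rho) (rename Some g).
  apply: (transfer_consequence star_elementary prem) => [r rP|[v|]].
  - apply/sat_rename.
    have -> : r \o Some = decode (r None).
      by apply/funext => v; have := rP (Some v); rewrite sat_atom2.
    by have := rP None; rewrite sat_atom1.
  - by rewrite sat_atom2; apply: rhoP.
  - rewrite sat_atom1; apply: xp; apply: filterS Ug => r.
    by rewrite /S /mkset theadE codeK.
by move/sat_rename.
Qed.

Lemma contains_pairs_neq0 (A : set (2.-tuple posnat)) :
  contains_pairs A -> A !=set0.
Proof.
move=> [H [infH HA]].
have /infinite_setN0[x Hx] := infH.
have [y Hy xy] := infinite_exists_gt x infH.
by exists [tuple x; y]; apply: HA.
Qed.

(** * From condition (2) to an ultrafilter on assignments *)

Section Variables.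
Context {m : nat} {l : 'I_m.+1 -> nat}.

(** This coding makes the variables a finite type, as transfer and realisation require. *)
Definition variable_code (v : variable l) : option (option {i & 'I_(l i)}) :=
  match v with
  | VarX => None
  | VarY => Some None
  | VarZ i j => Some (Some (Tagged (fun i => 'I_(l i)) j))
  end.

Definition variable_decode (v : option (option {i & 'I_(l i)})) : variable l :=
  match v with
  | None => VarX l
  | Some None => VarY l
  | Some (Some t) => VarZ (tagged t)
  end.

Lemma variable_codeK : cancel variable_code variable_decode.
Proof. by case. Qed.

HB.instance Definition _ := Finite.copy (variable l) (can_type variable_codeK).

Lemma assign_mktuple {T : Type} (r : variable l -> T) :
  assign (r (VarX l)) (r (VarY l))
    (fun s => [tuple r (VarZ j) | j < l s]) = r.
Proof. by apply/funext => -[||s j] //=; rewrite tnth_mktuple. Qed.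

(** These agreements of colours become the equivalences [same_type] of (3). An arbitrary type of
    colours lets two colourings be combined into a product. *)
Definition homogeneous {T : Type} (c : posnat -> T) (r : variable l -> posnat) :=
  (forall s (j k : 'I_(l s)), c (r (VarZ j)) = c (r (VarZ k))) /\
  (forall j : 'I_(l ord0), c (r (VarX l)) = c (r (VarZ j))).

Definition pairwise_PR (phi : formula (variable l)) : Prop :=
  forall (r : nat) (C : 'I_r -> set posnat), finite_colouring C ->
  exists H : set posnat, infinite_set H /\
    forall h1 h2, H h1 -> H h2 -> posnat_lt h1 h2 ->
    exists i : 'I_m.+1 -> 'I_r,
      [/\ C (i ord0) h1, C (i ord0) h2 &
        exists a : forall s, (l s).-tuple posnat,
          (forall s, list_in (a s) (C (i s))) /\
          holds (M := standard) phi h1 h2 a].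

(** The increasing pairs of the set [H] given by (2) split into those in [D] and those outside.
    Since [D] is in the ideal, the rest is not, by [Ramsey_union]; in particular it has an
    element. *)
Lemma homogeneous_solution (phi : formula (variable l)) {T : finType}
    (c : posnat -> T) (D : set (2.-tuple posnat)) :
  pairwise_PR phi -> ~ contains_pairs D ->
  exists r : variable l -> posnat, [/\ sat (M := standard) r phi,
    ~ D [tuple r (VarX l); r (VarY l)] & homogeneous c r].
Proof.
move=> phiPR thinD.
pose C (i : 'I_#|T|) : set posnat := [set x | enum_rank (c x) = i].
have colC : finite_colouring C.
  split; first by apply/seteqP; split=> // x _; exists (enum_rank (c x)).
  by move=> i j _ _ [x [<- <-]].
have [H [infH HC]] := phiPR _ _ colC.
have /contains_pairs_neq0[t [/= nDt [Ht1 Ht2 t12]]] :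
    contains_pairs (~` D `&` increasing_pairs H).
  have [||//] := Ramsey_union D (~` D `&` increasing_pairs H).
    by exists H; split=> // t Ht; have [|] := pselect (D t); [left|right].
  by [].
have [i [t1C t2C [a [aC aphi]]]] := HC _ _ Ht1 Ht2 t12.
exists (assign (coord1 t) (coord2 t) a); split=> //=; first by rewrite -tuple2E.
have Ca s j : enum_rank (c (tnth (a s) j)) = i s by apply: aC.
by split=> [s j k|j]; apply: enum_rank_inj; rewrite !Ca.
Qed.

(** The sets [base T c D] are nonempty by [homogeneous_solution]. Two of them contain a third in
    common: take the product colouring and the union of the sets [D], again in the ideal by
    [Ramsey_union]. Any ultrafilter containing them serves. *)
Lemma homogeneous_ultrafilter (phi : formula (variable l)) : pairwise_PR phi ->
  exists U : set_system (variable l -> posnat), [/\ UltraFilter U,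
    U [set r | sat (M := standard) r phi],
    forall D, ~ contains_pairs D ->
      U [set r | ~ D [tuple r (VarX l); r (VarY l)]] &
    forall (T : finType) (c : posnat -> T), U [set r | homogeneous c r]].
Proof.
move=> phiPR.
pose base (T : finType) (c : posnat -> T) D : set (variable l -> posnat) :=
  [set r | [/\ sat (M := standard) r phi,
    ~ D [tuple r (VarX l); r (VarY l)] & homogeneous c r]].
pose F : set_system (variable l -> posnat) := [set S |
  exists (T : finType) (c : posnat -> T) D,
    ~ contains_pairs D /\ base T c D `<=` S].
have thin0 : ~ contains_pairs set0 by move=> /contains_pairs_neq0[].
have F_phi : F [set r | sat (M := standard) r phi].
  by exists unit, (fun=> tt), set0; split=> // r [].
have PF : ProperFilter F.
  split.
    move=> [T [c [D [thinD]]]].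
    by have [r rD] := homogeneous_solution _ c _ phiPR thinD => /(_ r); apply.
  split=> [|A B|A B AB [T [c [D [thinD DA]]]]].
  - by exists unit, (fun=> tt), set0.
  - move=> [T [c [D [thinD DA]]]] [T' [c' [D' [thinD' DB]]]].
    exists (T * T')%type, (fun x => (c x, c' x)), (D `|` D').
    split=> [/Ramsey_union[]//|r [rphi /not_orP[nD nD'] [homZ homX]]].
    by split; [apply: DA|apply: DB]; split=> //; split=> [s j k|j];
      do [by have [] := homZ s j k | by have [] := homX j].
  - by exists T, c, D; split=> // r /DA /AB.
have [U [UU FU]] := ultraFilterLemma PF.
exists U; split=> // [|D thinD|T c]; apply: FU => //.
- by exists unit, (fun=> tt), D; split=> // r [].
- by exists T, c, set0; split=> // r [].
Qed.

End Variables.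

(** * From condition (2) to condition (3) *)

Lemma Ramsey_pair_of_pairwise_PR {M : structure} {star : posnat -> M}
    (star_elementary : elementary_embedding star)
    (M_saturated : continuum_succ_saturated M)
    {m : nat} {l : 'I_m.+1 -> nat} {phi : formula (variable l)} :
  pairwise_PR phi ->
  exists (alpha beta : M) (gamma : forall s, (l s).-tuple M),
    [/\ Ramsey_pair alpha beta,
        forall s (j k : 'I_(l s)),
          same_type (tnth (gamma s) j) (tnth (gamma s) k),
        forall l0 : (0 < l ord0)%N,
          same_type alpha (tnth (gamma ord0) (Ordinal l0)) &
        holds phi alpha beta gamma].
Proof.
move=> /homogeneous_ultrafilter[U [UU Uphi UD Uhom]].
have [rho rhoU] := realise_ultrafilter star_elementary M_saturated _ UU.
have rho_implies (f g : formula (variable l)) :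
    U [set r | sat (M := standard) r f -> sat (M := standard) r g] ->
    sat rho f -> sat rho g.
  by apply: (rhoU (Defs.Implies f g)).
(* Each set [S] is a colouring with two colours; agreement on it makes [S] belong to both
   ultrafilters or to neither. *)
have same_rho v w :
    (forall c : posnat -> bool, U [set r | c (r v) = c (r w)]) ->
    same_type (rho v) (rho w).
  move=> Uvw; apply/seteqP; split=> S; rewrite /ultra_of /mkset -!sat_atom1.
    apply: rho_implies; apply: filterS (Uvw (fun x => `[< S [tuple x] >])) => r.
    by rewrite /mkset !sat_atom1 => rvw /asboolP Sv; apply/asboolP; rewrite -rvw.
  apply: rho_implies; apply: filterS (Uvw (fun x => `[< S [tuple x] >])) => r.
  by rewrite /mkset !sat_atom1 => rvw /asboolP Sv; apply/asboolP; rewrite rvw.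
exists (rho (VarX l)), (rho (VarY l)), (fun s => [tuple rho (VarZ j) | j < l s]).
split.
- split=> [|A aA]; first exact: ultra_of_ultrafilter.
  (* If [A] were in the ideal, [U]-most assignments would violate it, and so would [rho]. *)
  apply: contrapT => /UD thinA.
  apply: (rho_implies (Atom A [tuple VarX l; VarY l]) (Falsum _)).
    by apply: filterS thinA => r; rewrite /mkset sat_atom2.
  by rewrite sat_atom2.
- move=> s j k; rewrite !tnth_mktuple; apply: same_rho => c.
  by apply: filterS (Uhom _ c) => r [homZ _]; apply: homZ.
- move=> l0; rewrite tnth_mktuple; apply: same_rho => c.
  by apply: filterS (Uhom _ c) => r [_]; apply.
- by rewrite /holds assign_mktuple; apply: rhoU.
Qed.

(** * From condition (3) to condition (4) *)

Section RamseyPair.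
Context {M : structure} {star : posnat -> M}.
Hypothesis star_elementary : elementary_embedding star.

(** This identifies the first projection of the ultrafilter of a pair with the ultrafilter of its
    first entry; the equivalence is immediate for standard pairs and transfers. *)
Lemma interp_coord1 (a b : M) (A : set posnat) :
  interp M (coord1 @^-1` A) [tuple a; b] <->
  interp M [set t : 1.-tuple posnat | A (thead t)] [tuple a].
Proof.
pose rho (i : bool) := if i then a else b.
pose f := Atom (coord1 @^-1` A) [tuple true; false].
pose g := Atom [set t : 1.-tuple posnat | A (thead t)] [tuple true].
have fg := transfer_consequence star_elementary (fun _ : unit => f) g.
have gf := transfer_consequence star_elementary (fun _ : unit => g) f.
split=> Aa.
  have := fg _ rho; rewrite /f /g !sat_atom1 !sat_atom2; apply=> // r /(_ tt).
  by rewrite sat_atom1 sat_atom2.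
have := gf _ rho; rewrite /f /g !sat_atom1 !sat_atom2; apply=> // r /(_ tt).
by rewrite sat_atom1 sat_atom2.
Qed.

Lemma ultrafilters_of_Ramsey_pair {m : nat} {l : 'I_m.+1 -> nat}
    {phi : formula (variable l)} {alpha beta : M}
    {gamma : forall s, (l s).-tuple M} :
  Ramsey_pair alpha beta ->
  (forall s (j k : 'I_(l s)),
     same_type (tnth (gamma s) j) (tnth (gamma s) k)) ->
  (forall l0 : (0 < l ord0)%N,
     same_type alpha (tnth (gamma ord0) (Ordinal l0))) ->
  holds phi alpha beta gamma ->
  exists (u : set_system (2.-tuple posnat))
         (w : 'I_m.+1 -> set_system posnat),
    [/\ Ramsey_witness u,
        forall s, UltraFilter (w s),
        fmap coord1 u = w ord0 &
        forall (A : set (2.-tuple posnat)) (B : 'I_m.+1 -> set posnat),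
          u A -> (forall s, w s (B s)) ->
          exists H : set posnat,
            [/\ infinite_set H, H `<=` B ord0, increasing_pairs H `<=` A &
              forall h1 h2, H h1 -> H h2 -> posnat_lt h1 h2 ->
              exists b : forall s, (l s).-tuple posnat,
                (forall s, list_in (b s) (B s)) /\
                holds (M := standard) phi h1 h2 b]].
Proof.
move=> RP gamma_same alpha_same phi_abc.
(* The first entry of the list represents its common type. The default [alpha] for an empty list
   ensures that [w ord0] is the projection of [u] even when the first list is empty. *)
pose rep s : M := if insub 0 is Some j then tnth (gamma s) j else alpha.
have rep_same s (j : 'I_(l s)) : same_type (rep s) (tnth (gamma s) j).
  by rewrite /rep insubT ?(leq_ltn_trans _ (ltn_ord j)) // => l0.
have rep_alpha : same_type (rep ord0) alpha.
  rewrite /rep; case: insubP => [j j0 jE|//].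
  have l0 : (0 < l ord0)%N by [].
  have -> : j = Ordinal l0 by apply: val_inj.
  by rewrite /same_type -alpha_same.
pose w s : set_system posnat := fmap (@thead 0 posnat) (ultra_of [tuple rep s]).
exists (ultra_of [tuple alpha; beta]), w; split=> [//|s||A B uA wB].
- exact/ultrafilter_fmap/(ultra_of_ultrafilter star_elementary).
- by rewrite /w rep_alpha; apply/funext => A; apply/propext/interp_coord1.
have [uU uR] := RP.
pose D : set (2.-tuple posnat) := [set t |
  exists b : forall s, (l s).-tuple posnat,
  (forall s, list_in (b s) (B s)) /\
  holds (M := standard) phi (coord1 t) (coord2 t) b].
have uD : ultra_of [tuple alpha; beta] D.
  pose prem (i : option {s & 'I_(l s)}) : formula (variable l) :=
    if i is Some t then
      Atom [set x : 1.-tuple posnat | B (tag t) (thead x)]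
        [tuple VarZ (tagged t)]
    else phi.
  have := transfer_consequence star_elementary prem
    (Atom D [tuple VarX l; VarY l]) _ (assign alpha beta gamma).
  rewrite sat_atom2; apply=> [r rP|[[s j]|//]]; last first.
    rewrite sat_atom1 /=.
    have : ultra_of [tuple tnth (gamma s) j] [set x | B s (thead x)].
      by rewrite -rep_same; apply: wB.
    by [].
  rewrite sat_atom2; exists (fun s => [tuple r (VarZ j) | j < l s]); split.
    move=> s j; rewrite tnth_mktuple.
    by have := rP (Some (Tagged (fun s => 'I_(l s)) j)); rewrite sat_atom1.
  by rewrite /holds assign_mktuple; apply: (rP None).
have uB : ultra_of [tuple alpha; beta] (coord1 @^-1` B ord0).
  by apply/interp_coord1; have := wB ord0; rewrite /w rep_alpha.
have [H [infH HABD]] := uR _ (filterI uA (filterI uB uD)).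
exists H; split=> // [h Hh|t /HABD[]//|h1 h2 Hh1 Hh2 h12].
  (* Each [h] in [H] is the first coordinate of an increasing pair, as [H] is unbounded, so it
     inherits membership in [B ord0]. *)
  have [k Hk hk] := infinite_exists_gt h infH.
  by have [_ []] : (A `&` (coord1 @^-1` B ord0 `&` D)) [tuple h; k]
    by apply: HABD.
by have [_ []] : (A `&` (coord1 @^-1` B ord0 `&` D)) [tuple h1; h2]
  by apply: HABD.
Qed.

End RamseyPair.

Theorem theorem3p8 (M : structure) (star : posnat -> M)
    (star_elementary : elementary_embedding star)
    (M_saturated : continuum_succ_saturated M)
    (m : nat) (l : 'I_m.+1 -> nat) (phi : formula (variable l)) :
  [<->
    Ramsey_PR phi;

    forall (r : nat) (C : 'I_r -> set posnat), finite_colouring C ->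
    exists H : set posnat, infinite_set H /\
      forall h1 h2, H h1 -> H h2 -> posnat_lt h1 h2 ->
      exists i : 'I_m.+1 -> 'I_r,
        [/\ C (i ord0) h1, C (i ord0) h2 &
          exists a : forall s, (l s).-tuple posnat,
            (forall s, list_in (a s) (C (i s))) /\
            holds (M := standard) phi h1 h2 a];

    exists (alpha beta : M) (gamma : forall s, (l s).-tuple M),
      [/\ Ramsey_pair alpha beta,
          forall s (j k : 'I_(l s)),
            same_type (tnth (gamma s) j) (tnth (gamma s) k),
          forall l0 : (0 < l ord0)%N,
            same_type alpha (tnth (gamma ord0) (Ordinal l0)) &
          holds phi alpha beta gamma];

    exists (u : set_system (2.-tuple posnat))
           (w : 'I_m.+1 -> set_system posnat),
      [/\ Ramsey_witness u,
          forall s, UltraFilter (w s),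
          fmap coord1 u = w ord0 &
          forall (A : set (2.-tuple posnat)) (B : 'I_m.+1 -> set posnat),
            u A -> (forall s, w s (B s)) ->
            exists H : set posnat,
              [/\ infinite_set H, H `<=` B ord0, increasing_pairs H `<=` A &
                forall h1 h2, H h1 -> H h2 -> posnat_lt h1 h2 ->
                exists b : forall s, (l s).-tuple posnat,
                  (forall s, list_in (b s) (B s)) /\
                  holds (M := standard) phi h1 h2 b]]
  ].
Proof.
tfae.
- move=> phiPR r C /phiPR[i [H [infH HC phiH]]].
  exists H; split=> // h1 h2 Hh1 Hh2 h12.
  by exists i; split; [apply: HC|apply: HC|apply: phiH].
- exact: Ramsey_pair_of_pairwise_PR.
- move=> [alpha [beta [gamma [RP gamma_same alpha_same phi_abc]]]].
  exact: ultrafilters_of_Ramsey_pair phi_abc.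
- move=> [u [w [[uU _] wU _ uwphi]]] r C [CT _].
  (* Each ultrafilter selects a colour class; (4) for these classes and the set of all pairs yields
     (1). *)
  have /choice[i wC] : forall s, exists i, w s (C i).
    by move=> s; apply: ultrafilter_colour.
  have [H [infH HC _ phiH]] := uwphi setT (C \o i) filterT wC.
  by exists i, H.
Qed.
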